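(* Let $q$ be a prime power of the form $q=12c^2+4c+3$ for some integer $c$, and let $n=q^2$. Then there exists a difference family with parameters $(2n;n,n,n,n-1;2n-2)$ in the group $\mathbb{Z}_2\times(\mathbb{F}_{q^2},+)$.
   Context: Let $(G,+)$ be a finite abelian group. For subsets $B_1,\dots,B_\ell\subseteq G$ with $|B_i|=k_i$, the collection $\{B_1,\dots,B_\ell\}$ is a difference family with parameters $(v;k_1,\dots,k_\ell;\lambda)$ in $G$ (where $v=|G|$) if the multiset of differences $x-y$ with $x,y\in B_i$, $x\neq y$, $i=1,\dots,\ell$, contains every nonzero element of $G$ exactly $\lambda$ times. *)

(* Defs.v *)
From HB Require Import structures.
From mathcomp Require Import all_boot all_order all_algebra all_fingroup all_field.
Set Implicit Arguments. Unset Strict Implicit. Unset Printing Implicit Defensive.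
Import GRing.Theory.
Local Open Scope ring_scope.

(* make products of finite Z-modules into finZmodTypes (e.g. 'Z_2 * F) *)
HB.saturate prod.

Definition diff_count (G : finZmodType) (B : {set G}) (g : G) : nat :=
  #|[set p : G * G | [&& p.1 \in B, p.2 \in B, p.1 != p.2 & p.1 - p.2 == g]]|.

Definition is_difference_family (G : finZmodType) (l : nat)
  (B : 'I_l -> {set G}) (k : 'I_l -> nat) (lam : nat) : Prop :=
  (forall i, #|B i| = k i) /\
  (forall g : G, g != 0 -> (\sum_(i < l) diff_count (B i) g)%N = lam).

Definition prime_power (q : nat) : Prop :=
  exists p k : nat, [/\ prime p, (0 < k)%N & q = (p ^ k)%N].

(* Main.v *)
Require Import Defs.
From HB Require Import structures.
From mathcomp Require Import all_boot all_order all_algebra all_fingroup all_field.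
From mathcomp Require Import cyclic ring zify.
Import GRing.Theory Num.Theory.

Set Implicit Arguments. Unset Strict Implicit. Unset Printing Implicit Defensive.
Local Open Scope ring_scope.

(* The form of [q] only matters through [q = 3 mod 8]. Describe a block by a
   function [f = +-1] on [Z_2 * F]; the blocks form the required family as soon
   as the autocorrelations of the four functions add up to [-4] off [0]. On each
   quartic class of [F] either half of a block is, up to sign, one of two
   functions: a sign [s] that is constant on the lines of [F] over [F_q] and adds
   up to [1] over the lines of each quartic class (their number (q+1)/4 is odd),
   or the octic sign, which is [1] on [C_j] and [-1] on [C_(j+4)].
   For [a <> 0] the Fourier transform of [s] on [C_j] is [+-q - 1] or [-1],
   according as the line on which [x |-> psi (a x)] is trivial lies in [C_j] or
   not. That of the octic sign is a period [gauss (j + cl8 a)], odd in [a]; the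
   Frobenius map [x |-> x ^ q] acts on the octic classes as multiplication by 3,
   so [gauss 2 = 0] and [gauss 1 = gauss 3], and Plancherel's formula gives
   [gauss 0 ^ 2 + 2 * gauss 1 ^ 2 = - q ^ 2]. These identities alone make the
   power spectra of the four blocks add up to a constant at all [a <> 0]. *)

(** * Fourier transform on the additive group of a finite field *)

Section Fourier.

Variables (F : finFieldType) (psi : F -> algC).
Hypothesis psiD : {morph psi : x y / x + y >-> x * y}.

(** Translating by [z] preserves the sum and also multiplies it by [psi z]. It serves with [K] the
    whole field and with [K] the subfield of order [q]. *)
Lemma sum_char_coset (K : {pred F}) (z : F) :
  (forall x, (x + z \in K) = (x \in K)) -> psi z != 1 ->
  \sum_(x in K) psi x = 0.
Proof.
move=> Kz psiz.
have: \sum_(x in K) psi x = psi z * \sum_(x in K) psi x.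
  rewrite [LHS](reindex_inj (addIr z)) /= big_distrr /=.
  apply: eq_big => [x|x _]; first by rewrite Kz.
  by rewrite psiD mulrC.
move/eqP; rewrite -subr_eq0 -{1}[X in X - _]mul1r -mulrBl mulf_eq0 subr_eq0.
by rewrite eq_sym (negPf psiz) => /eqP.
Qed.

Hypothesis psi0 : psi 0 = 1.
Hypothesis psi_neq1 : exists z, psi z != 1.

Definition hat (f : F -> algC) (a : F) : algC := \sum_x f x * psi (a * x).

Lemma sum_char_mul (b : F) :
  \sum_a psi (a * b) = if b == 0 then #|F|%:R else 0.
Proof.
have [->|b0] := eqVneq b 0.
  by under eq_bigr do rewrite mulr0 psi0; rewrite sumr_const.
rewrite (reindex_inj (mulIf (invr_neq0 b0))) /=.
under eq_bigr do rewrite mulfVK //.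
by have [z /(@sum_char_coset predT)->] := psi_neq1.
Qed.

(** Orthogonality of characters keeps only the terms [x = y + h]. Evaluating at [- a] replaces
    complex conjugation for real-valued [g]. *)
Lemma plancherel (f g : F -> algC) (h : F) :
  \sum_a hat f a * hat g (- a) * psi (- (a * h)) =
  #|F|%:R * \sum_y f (y + h) * g y.
Proof.
transitivity (\sum_a \sum_x \sum_y f x * g y * psi (a * (x - y - h))).
  apply: eq_bigr => a _; rewrite /hat !big_distrl /=; apply: eq_bigr => x _.
  rewrite big_distrr big_distrl /=; apply: eq_bigr => y _.
  by rewrite mulNr !mulrBr !psiD mulrACA !mulrA.
rewrite exchange_big /=; under eq_bigr do rewrite exchange_big /=.
rewrite exchange_big /= big_distrr /=; apply: eq_bigr => y _.
under eq_bigr do rewrite -big_distrr sum_char_mul.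
rewrite (bigD1 (y + h)) //= [y + h - _ - _]addrAC addrK subrr eqxx big1 ?addr0.
  by rewrite mulrC.
by move=> x xyh; rewrite -addrA -opprD subr_eq0 (negPf xyh) mulr0.
Qed.

End Fourier.

(** * A nontrivial additive character and a generator of the unit group *)

Lemma exists_char (F : finFieldType) : exists psi : F -> algC,
  [/\ {morph psi : x y / x + y >-> x * y}, psi 0 = 1 & exists z, psi z != 1].
Proof.
have [p pp cF] := finPcharP F.
pose V := pPrimeCharType cF : vectType 'F_p.
have [z zP] := C_prim_root_exists (prime_gt0 pp).
pose b := vbasis {: V}.
have d0 : (0 < \dim {:V})%N.
  rewrite lt0n dimv_eq0 -subv0; apply/negP => /subvP /(_ (1 : F) (memvf _)).
  by rewrite memv0; apply/negP; exact: oner_neq0.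
pose l (x : F) : 'F_p := coord b (Ordinal d0) (x : V).
have lD : {morph l : x y / x + y} by move=> x y; exact: (raddfD (coord b _)).
(* Addition in ['F_p] reduces modulo this expression, which equals [p], the order of [z]. *)
have zm m : z ^+ (m %% (Zp_trunc (pdiv p)).+2) = z ^+ m.
  by rewrite Fp_cast // (prim_expr_mod zP).
exists (fun x => z ^+ l x); split.
- by move=> x y; rewrite lD -exprD; exact: zm.
- by have -> : l 0 = 0 by exact: (raddf0 (coord b _)).
exists b`_(Ordinal d0).
have -> : l b`_(Ordinal d0) = 1.
  by rewrite /l coord_free ?eqxx // (basis_free (vbasisP _)).
have -> : z ^+ (1%R : 'F_p) = z by exact: (zm 1%N).
apply: contraTneq (prime_gt1 pp) => z1; rewrite -leqNgt dvdn_leq //.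
by rewrite (prim_order_dvd zP) expr1 z1.
Qed.

Lemma exists_prim_root (F : finFieldType) :
  exists w : F, (#|F|.-1).-primitive_root w.
Proof.
have F1 := finNzRing_gt1 F.
suff /hasP[w _ wP] : has (#|F|.-1).-primitive_root (enum (predC1 (0 : F))).
  by exists w.
apply: has_prim_root; first by rewrite -subn1 subn_gt0.
- apply/allP => x; rewrite mem_enum !inE unity_rootE => x0.
  apply/eqP/(mulfI x0); rewrite -exprS (ltn_predK F1) mulr1; exact: expf_card.
- exact: enum_uniq.
by rewrite -cardE cardC1.
Qed.

(** * Discrete logarithms *)

Section Log.

Variables (F : finFieldType) (N : nat) (w : F).
Hypotheses (FN : #|F| = N.+1) (wP : N.-primitive_root w).

(** At 0, which is no power of [w], the value is the default [N]. *)
Definition dlog (x : F) : nat := index x [seq w ^+ i | i <- iota 0 N].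

Let N0 : (0 < N)%N := prim_order_gt0 wP.

Lemma prim_root_neq0 : w != 0.
Proof.
apply/eqP => w0; have := prim_expr_order wP.
by rewrite w0 expr0n gtn_eqF // => /esym/eqP; rewrite oner_eq0.
Qed.

Lemma dlog_mem (x : F) : x != 0 -> x \in [seq w ^+ i | i <- iota 0 N].
Proof.
move=> x0; have xN : x ^+ N = 1.
  by apply: (mulfI x0); rewrite -exprS -FN mulr1; exact: expf_card.
have [i ->] := prim_rootP wP xN; apply/mapP; exists (i : nat) => //.
by rewrite mem_iota add0n /=.
Qed.

Lemma dlog_lt (x : F) : x != 0 -> (dlog x < N)%N.
Proof. by move/dlog_mem; rewrite -index_mem size_map size_iota. Qed.

Lemma dlogK (x : F) : x != 0 -> w ^+ dlog x = x.
Proof.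
move=> x0; have := nth_index 0 (dlog_mem x0).
by rewrite -/(dlog x) (nth_map 0%N) ?size_iota ?nth_iota ?dlog_lt.
Qed.

Lemma dlog_expr (m : nat) : dlog (w ^+ m) = (m %% N)%N.
Proof.
have w0 : w ^+ m != 0 by rewrite expf_neq0 // prim_root_neq0.
apply/eqP; rewrite -[dlog _](modn_small (dlog_lt w0)).
by rewrite -(eq_prim_root_expr wP) dlogK.
Qed.

Lemma dlogM (x y : F) : x != 0 -> y != 0 ->
  dlog (x * y) = ((dlog x + dlog y) %% N)%N.
Proof. by move=> x0 y0; rewrite -dlog_expr exprD !dlogK. Qed.

Lemma sum_dlog (f : nat -> algC) :
  \sum_(x | x != 0) f (dlog x) = \sum_(0 <= i < N) f i.
Proof.
rewrite big_mkord (reindex (fun i : 'I_N => w ^+ i)) /=.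
  apply: eq_big => [i|i _]; last by rewrite dlog_expr modn_small.
  by rewrite expf_neq0 // prim_root_neq0.
exists (fun x => insubd (Ordinal N0) (dlog x)) => [i|x x0].
  by move=> _; apply: ord_inj; rewrite val_insubd dlog_expr modn_small ?ltn_ord.
by rewrite val_insubd dlog_lt ?dlogK.
Qed.

End Log.

(** * A character that factors through the trace to the subfield of order [q] *)

(** A nontrivial character is composed with a multiple of the trace [x + x ^ q]; the trace is
    invariant under [x |-> x ^ q] and vanishes exactly when [x ^ q = - x]. *)
Lemma exists_trace_char (F : finFieldType) (q : nat) :
  [pchar F].-nat q -> (2 < q)%N -> #|F| = (q ^ 2)%N ->
  exists psi : F -> algC,
  [/\ {morph psi : x y / x + y >-> x * y}, psi 0 = 1,
      forall x, psi (x ^+ q) = psi x,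
      forall x, x ^+ q = - x -> psi x = 1 &
      forall x, x ^+ q != - x -> exists2 t, t ^+ q = t & psi (x * t) != 1].
Proof.
move=> qF q2 FN; have [psi [psiD psi0 [z zP]]] := exists_char F.
have frobD (x y : F) : (x + y) ^+ q = x ^+ q + y ^+ q by exact: exprDn_pchar.
have frob2 (x : F) : x ^+ q ^+ q = x.
  by rewrite -exprM mulnn -FN; exact: expf_card.
have [w wP] := exists_prim_root F.
(* Otherwise [w ^ (q - 1) = -1], and the order of [w] would divide [2 (q - 1)], which is less than
   [q ^ 2 - 1]. *)
have w0 : w + w ^+ q != 0.
  rewrite addrC addr_eq0; apply/eqP => wq.
  have : w ^+ (2 * (q - 1)) == 1.
    have wn0 := prim_root_neq0 wP.
    have -> : w ^+ (2 * (q - 1)) = (w ^+ (q - 1)) ^+ 2 by rewrite mulnC exprM.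
    have -> : w ^+ (q - 1) = -1.
      apply: (mulfI wn0); rewrite -exprS mulrN1 -wq; congr (_ ^+ _); lia.
    by rewrite sqrrN expr1n.
  rewrite -(prim_order_dvd wP) FN => /dvdn_leq; nia.
exists (fun x => psi (z / (w + w ^+ q) * (x + x ^+ q))); split.
- by move=> x y; rewrite frobD addrACA mulrDr psiD.
- by rewrite expr0n gtn_eqF ?addr0 ?mulr0 //; lia.
- by move=> x; rewrite frob2 [x ^+ q + _]addrC.
- by move=> x ->; rewrite subrr mulr0.
move=> x; rewrite -addr_eq0 addrC => x0.
(* This quotient of traces lies in the subfield, and multiplying [x] by it gives an element with the
   trace of [w], where the character is [psi z]. *)
have tq : ((w + w ^+ q) / (x + x ^+ q)) ^+ q = (w + w ^+ q) / (x + x ^+ q).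
  by rewrite exprMn exprVn !frobD !frob2 ![_ ^+ q + _]addrC.
exists ((w + w ^+ q) / (x + x ^+ q)) => //.
rewrite exprMn tq -mulrDl; suff -> : z / (w + w ^+ q) *
  ((x + x ^+ q) * ((w + w ^+ q) / (x + x ^+ q))) = z by [].
by field; rewrite x0 w0.
Qed.

(* [octic (cl8 x - j)] is 1 on the octic class [C_j], -1 on [C_(j+4)], and 0 elsewhere. *)
Definition octic (z : 'Z_8) : algC := [:: 1; 0; 0; 0; -1; 0; 0; 0]`_z.

Lemma Z8_ind (P : 'Z_8 -> Prop) :
  P 0 -> P 1 -> P 2%:R -> P 3%:R -> P 4%:R -> P 5%:R -> P 6%:R -> P 7%:R ->
  forall z, P z.
Proof.
move=> P0 P1 P2 P3 P4 P5 P6 P7 z; rewrite -(natr_Zp z).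
by case: (z : nat) (ltn_ord z) => [|[|[|[|[|[|[|[|]]]]]]]].
Qed.

Lemma octicD4 (z : 'Z_8) : octic (z + 4%:R) = - octic z.
Proof. by elim/Z8_ind: z; rewrite /octic /= ?opprK ?oppr0. Qed.

(** Multiplication by 3 fixes 0 and 4 and permutes the other residues, where [octic] vanishes. *)
Lemma octic3 (z : 'Z_8) : octic (3%:R * z) = octic z.
Proof. by elim/Z8_ind: z. Qed.

(** * Octic classes and their Gaussian periods *)

Section Sums.

Variables (F : finFieldType) (q : nat) (w : F) (psi : F -> algC).
Hypotheses (qF : [pchar F].-nat q) (q8 : (q %% 8 = 3)%N).
Hypotheses (FN : #|F| = (q ^ 2)%N) (wP : (q ^ 2).-1.-primitive_root w).
Hypotheses (psiD : {morph psi : x y / x + y >-> x * y}) (psi0 : psi 0 = 1).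
Hypotheses (psiq : forall x, psi (x ^+ q) = psi x).
Hypothesis psi_ker : forall x, x ^+ q = - x -> psi x = 1.
Hypothesis psi_nker :
  forall x, x ^+ q != - x -> exists2 t, t ^+ q = t & psi (x * t) != 1.

Let N := (q ^ 2).-1.

Let FN1 : #|F| = N.+1.
Proof. by rewrite FN /N prednK // expn_gt0; lia. Qed.

Let NE : N = (q.+1 * q.-1)%N.
Proof. rewrite /N; nia. Qed.

Let N8 : (8 %| N)%N.
(* For [q = 8 k + 3], [q + 1 = 4 (2 k + 1)] and [q - 1 = 2 (4 k + 1)]. *)
Proof. by rewrite NE; apply/dvdnP; exists ((q %/ 8 * 2 + 1) * (q %/ 8 * 4 + 1))%N; nia. Qed.

Let w0 : w != 0 := prim_root_neq0 wP.
Local Notation log := (dlog N w).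

Definition cl8 (x : F) : 'Z_8 := (log x)%:R.

Lemma cl8_expr (m : nat) : cl8 (w ^+ m) = m%:R.
Proof.
rewrite /cl8 (dlog_expr FN1 wP) !Zp_nat; apply: val_inj => /=.
by rewrite modn_dvdm.
Qed.

Lemma cl8M (x y : F) : x != 0 -> y != 0 -> cl8 (x * y) = cl8 x + cl8 y.
Proof.
move=> x0 y0; rewrite -(dlogK FN1 wP x0) -(dlogK FN1 wP y0) -exprD !cl8_expr.
by rewrite natrD.
Qed.

Lemma cl8X (x : F) (m : nat) : x != 0 -> cl8 (x ^+ m) = m%:R * cl8 x.
Proof.
by move=> x0; rewrite -(dlogK FN1 wP x0) -exprM !cl8_expr natrM mulrC.
Qed.

Lemma expr_half_order : w ^+ N./2 = -1.
Proof.
have N_even : N = N./2.*2 by have := N8; lia.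
have : (w ^+ N./2) ^+ 2 == 1 by rewrite -exprM muln2 -N_even (prim_expr_order wP).
rewrite sqrf_eq1 -(prim_order_dvd wP) => /orP[/dvdn_leq|/eqP //].
rewrite -/N NE; nia.
Qed.

(** [-1 = w ^ (N / 2)], and [N / 2] is an odd multiple of 4. *)
Lemma cl8N (x : F) : x != 0 -> cl8 (- x) = cl8 x + 4%:R.
Proof.
move=> x0; rewrite -mulN1r cl8M // ?oppr_eq0 ?oner_neq0 // addrC; congr (_ + _).
rewrite -expr_half_order cl8_expr !Zp_nat; apply: val_inj => /=; rewrite NE.
have [k ->] : exists k, q = (8 * k + 3)%N by exists (q %/ 8)%N; lia.
have -> : ((8 * k + 3).+1 * (8 * k + 3).-1)./2 = ((4 * k * k + 3 * k) * 8 + 4)%N by lia.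
by rewrite modnMDl.
Qed.

Definition gauss (j : 'Z_8) : algC := \sum_(x | x != 0) octic (cl8 x - j) * psi x.

Lemma gauss_shift (a : F) (j : 'Z_8) : a != 0 ->
  \sum_(x | x != 0) octic (cl8 x - j) * psi (a * x) = gauss (j + cl8 a).
Proof.
move=> a0; rewrite /gauss [RHS](reindex_inj (mulfI a0)) /=.
apply: eq_big => [x|x x0]; first by rewrite mulf_eq0 (negPf a0).
by rewrite cl8M //; congr (octic _ * _); ring.
Qed.

Lemma gaussD4 (j : 'Z_8) : gauss (j + 4%:R) = - gauss j.
Proof.
rewrite /gauss -sumrN; apply: eq_bigr => x _.
rewrite -mulNr -octicD4; congr (octic _ * _).
by rewrite opprD addrA; congr (_ + _); exact: val_inj.
Qed.

(** The substitution [x |-> x ^ q] preserves [psi] and multiplies octic classes by [q = 3]. *)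
Lemma gauss3 (j : 'Z_8) : gauss (3%:R * j) = gauss j.
Proof.
have q3 : (q%:R : 'Z_8) = 3%:R by rewrite !Zp_nat; apply: val_inj; rewrite /= q8.
have frob_inj : injective (fun x : F => x ^+ q).
  apply: (can_inj (g := fun x => x ^+ q)) => x.
  by rewrite -exprM mulnn -FN; exact: expf_card.
rewrite /gauss [LHS](reindex_inj frob_inj) /=.
have q0 : (0 < q)%N by lia.
apply: eq_big => [x|x]; rewrite expf_eq0 q0 //= => x0.
by rewrite cl8X // q3 -mulrBr octic3 psiq.
Qed.

Lemma gauss2 : gauss 2%:R = 0.
Proof.
have := gaussD4 2%:R; have := gauss3 2%:R.
have -> : (3%:R * 2%:R = 2%:R + 4%:R :> 'Z_8) by exact: val_inj.
by move=> -> /esym/eqP; rewrite eqNr => /eqP.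
Qed.

(** The range covers every sum of a class below 8 and an index below 4, so no reduction modulo 8 is
    needed later. *)
Lemma gauss_table (k : nat) : (k < 12)%N ->
  gauss k%:R = [:: gauss 0; gauss 1; 0; gauss 1; - gauss 0; - gauss 1; 0; - gauss 1;
                   gauss 0; gauss 1; 0; gauss 1]`_k.
Proof.
have D4 m : gauss (4 + m)%:R = - gauss m%:R by rewrite addnC natrD gaussD4.
have g3 : gauss 3%:R = gauss 1%:R by rewrite -(gauss3 1) mulr1.
do 12?[case: k => [|k] //=] => _;
  rewrite ?(D4 7%N) ?(D4 6%N) ?(D4 5%N) ?(D4 4%N) ?(D4 3%N) ?(D4 2%N) ?(D4 1%N);
  by rewrite ?(D4 0%N) ?gauss2 ?g3 ?opprK ?oppr0.
Qed.

(** The offset 4 prevents truncation in [k - m]; the difference [-4] does not occur since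
    [m < 4]. *)
Lemma octic_table (k m : nat) : (k < 8)%N -> (m < 4)%N ->
  octic (k%:R - m%:R) = [:: 0; 0; 0; 0; 1; 0; 0; 0; -1; 0; 0; 0]`_(4 + k - m).
Proof.
by do 8?[case: k => [|k] //=]; do 4?[case: m => [|m] //=].
Qed.

Lemma Z8_nat (z : 'Z_8) : exists2 k, (k < 8)%N & z = k%:R.
Proof. by exists z; rewrite ?natr_Zp. Qed.

Lemma sum_octic (j : 'Z_8) : \sum_(x | x != 0) octic (cl8 x - j) = 0.
Proof.
apply/eqP; rewrite -eqNr [in eqbRHS](reindex_inj oppr_inj) -sumrN /=.
apply/eqP/eq_big => [x|x x0]; first by rewrite oppr_eq0.
by rewrite cl8N // addrAC octicD4.
Qed.

Lemma psi_neq1 : exists z, psi z != 1.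
Proof.
have := @psi_nker 1; rewrite expr1n => /(_ _)[]; last by move=> t _; exists (1 * t).
rewrite eq_sym; have : w ^+ N./2 != 1.
  rewrite -(prim_order_dvd wP) gtnNdvd //; rewrite -/N NE; nia.
by rewrite expr_half_order.
Qed.

(** Plancherel at shift 0 is summed over four octic signs. Four consecutive periods have squares
    [gauss 0 ^ 2], [gauss 1 ^ 2], 0, [gauss 1 ^ 2] in some order, while the squared signs add up to
    1 at each nonzero point; the factor [N] then cancels. *)
Lemma gauss_norm : gauss 0 ^+ 2 + 2 * gauss 1 ^+ 2 = - (q ^ 2)%:R.
Proof.
(* The case [x = 0] is separated because the default [cl8 0] is a genuine class. *)
pose f (j : 'Z_8) x := if x == 0 then 0 else octic (cl8 x - j).
have hatE j a : hat psi (f j) a = \sum_(x | x != 0) octic (cl8 x - j) * psi (a * x).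
  rewrite /hat (bigD1 0) //= /f eqxx mul0r add0r.
  by apply: eq_bigr => x /negPf ->.
have hat0 j : hat psi (f j) 0 = 0.
  rewrite hatE -[RHS](sum_octic j); apply: eq_bigr => x _.
  by rewrite mul0r psi0 mulr1.
have hatn j a : a != 0 -> hat psi (f j) a = gauss (j + cl8 a).
  by move=> a0; rewrite hatE gauss_shift.
have PL (j : 'Z_8) : \sum_(a | a != 0) - gauss (j + cl8 a) ^+ 2 =
    (q ^ 2)%:R * \sum_(y | y != 0) octic (cl8 y - j) ^+ 2.
  have := plancherel psiD psi0 psi_neq1 (f j) (f j) 0; rewrite FN.
  rewrite (bigD1 0) //= hat0 !mul0r add0r [X in _ = _ * X](bigD1 0) //=.
  rewrite addr0 /f eqxx mul0r add0r => E.
  transitivity (\sum_(a | a != 0) hat psi (f j) a * hat psi (f j) (- a) * psi (- (a * 0))).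
    apply: eq_bigr => a a0; rewrite !hatn ?oppr_eq0 // cl8N // addrA gaussD4.
    by rewrite mulr0 oppr0 psi0 mulr1 mulrN expr2.
  rewrite E; congr (_ * _); apply: eq_bigr => y /negPf y0.
  by rewrite addr0 y0 expr2.
have : \sum_(0 <= j < 4) \sum_(a | a != 0) - gauss (j%:R + cl8 a) ^+ 2 =
   \sum_(0 <= j < 4) (q ^ 2)%:R * \sum_(y | y != 0) octic (cl8 y - j%:R) ^+ 2.
  by apply: eq_bigr => j _; exact: PL.
rewrite -big_distrr /= exchange_big [in X in _ = X]exchange_big /=.
have sum_gauss a : \sum_(0 <= j < 4) - gauss (j%:R + cl8 a) ^+ 2 =
            - (gauss 0 ^+ 2 + 2 * gauss 1 ^+ 2).
  rewrite !big_nat_recr ?big_geq //=.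
  have [k k8 ->] := Z8_nat (cl8 a); rewrite -!natrD.
  do 8?[case: k k8 => [|k] k8 //]; rewrite !gauss_table //=; ring.
have sum_octic2 a : \sum_(0 <= j < 4) octic (cl8 a - j%:R) ^+ 2 = 1.
  rewrite !big_nat_recr ?big_geq //=.
  have [k k8 ->] := Z8_nat (cl8 a).
  do 8?[case: k k8 => [|k] k8 //]; rewrite !octic_table //=; ring.
under eq_bigr do rewrite sum_gauss.
under [in X in _ = X]eq_bigr do rewrite sum_octic2.
rewrite !sumr_const cardC1 FN1 /=.
have n0 : (N%:R : algC) != 0 by rewrite pnatr_eq0 NE; nia.
by move=> E; apply: (mulIf n0); rewrite mulNr -E mulNrn opprK mulr_natr.
Qed.

(** * Character sums over the lines through 0 *)

(* [kap] spans the line [x ^ q = - x], the only one on which [psi] is trivial. *)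
Definition kap : F := w ^+ (q.+1)./2.

Lemma kap_neq0 : kap != 0. Proof. by rewrite expf_neq0. Qed.

Lemma kapXq : kap ^+ q = - kap.
Proof.
rewrite -mulN1r -expr_half_order -exprM -exprD; congr (_ ^+ _); rewrite NE.
have [k ->] : exists k, q = k.*2.+1 by exists q./2; lia.
have -> : ((k.*2.+2 * k.*2)./2 = (k.+1 * k).*2)%N by lia.
have -> : k.*2.+2./2 = k.+1 by lia.
lia.
Qed.

Lemma dlog_fixed (t : F) : t != 0 -> t ^+ q = t -> (q.+1 %| log t)%N.
Proof.
move=> t0 tq; have : t ^+ q.-1 == 1.
  apply/eqP/(mulfI t0); rewrite -exprS prednK ?mulr1 //; lia.
rewrite -{1}(dlogK FN1 wP t0) -exprM -(prim_order_dvd wP) -/N.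
rewrite [X in (X %| _)%N]NE dvdn_pmul2r //; lia.
Qed.

(** The nonzero fixed points are the [q - 1] powers of [w ^ (q + 1)]. *)
Lemma card_fixed : #|[pred t : F | t ^+ q == t]| = q.
Proof.
rewrite (cardD1 0) !inE expr0n gtn_eqF; last by lia.
rewrite eqxx -[RHS](@prednK q); last by lia.
congr _.+1; rewrite -[RHS]card_ord.
have inj : injective (fun i : 'I_q.-1 => w ^+ (q.+1 * i)).
  move=> i j /eqP; rewrite (eq_prim_root_expr wP) -/N NE => ij; apply: ord_inj.
  by move: ij; rewrite !modn_small ?ltn_pmul2l // => /eqP; nia.
rewrite -(card_codom inj); apply: eq_card => t; rewrite !inE.
apply/andP/codomP => [[t0 tq]|[i ->]]; last first.
  rewrite expf_neq0 // -exprM (eq_prim_root_expr wP) -/N NE.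
  split=> //; rewrite (_ : q.+1 * i * q = i * (q.+1 * q.-1) + q.+1 * i)%N; last by nia.
  by rewrite modnMDl.
have /dvdnP[i def_i] := dlog_fixed t0 (eqP tq).
have i_lt : (i < q.-1)%N.
  by have := dlog_lt FN1 wP t0; rewrite def_i NE mulnC ltn_pmul2l.
by exists (Ordinal i_lt); rewrite /= mulnC -def_i (dlogK FN1 wP).
Qed.

Lemma sum_line (x : F) :
  \sum_(t | t ^+ q == t) psi (x * t) = if x ^+ q == - x then q%:R else 0.
Proof.
have [xq|xq] := eqVneq.
  rewrite (eq_bigr (fun=> 1)) => [|t /eqP tq]; last first.
    by apply: psi_ker; rewrite exprMn xq tq mulNr.
  by rewrite sumr_const card_fixed.
have [t tq xt] := psi_nker xq.
apply: (@sum_char_coset F (fun t => psi (x * t)) _ [pred t | t ^+ q == t] t) => //.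
  by move=> y z; rewrite mulrDr psiD.
by move=> y; rewrite !inE exprDn_pchar // tq (inj_eq (addIr t)).
Qed.

(** Averaging over the nonzero scalars [t] of the subfield turns [psi (a * x)] into a sum over a
    punctured line: [q - 1] if [x] lies on the line of [kap / a], and [-1] otherwise. The factor
    [q - 1] counts the scalars. *)
Lemma sum_line_invariant (e : F -> algC) (a : F) : a != 0 ->
  (forall x t, x != 0 -> t != 0 -> t ^+ q = t -> e (x * t) = e x) ->
  q.-1%:R * \sum_(x | x != 0) e x * psi (a * x) =
  (q * q.-1)%:R * e (kap / a) - \sum_(x | x != 0) e x.
Proof.
move=> a0 eK.
have kap0 := kap_neq0.
have sumK (y : F -> algC) : \sum_(t | (t ^+ q == t) && (t != 0)) y t =
    \sum_(t | t ^+ q == t) y t - y 0.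
  rewrite [in RHS](bigD1 0) /=; last by rewrite expr0n gtn_eqF //; lia.
  by rewrite [RHS]addrC addKr.
have cardK : \sum_(t : F | (t ^+ q == t) && (t != 0)) 1 = q.-1%:R :> algC.
  by rewrite sumK sumr_const card_fixed -subn1 natrB //; lia.
transitivity (\sum_(x | x != 0) e x *
    \sum_(t | (t ^+ q == t) && (t != 0)) psi (a * x * t)).
  rewrite -cardK big_distrl /=.
  transitivity (\sum_(t | (t ^+ q == t) && (t != 0))
                 \sum_(x | x != 0) e x * psi (a * x * t)).
    apply: eq_bigr => t /andP[/eqP tq t0]; rewrite mul1r.
    rewrite (reindex_inj (mulIf t0)) /=; apply: eq_big => [x|x].
      by rewrite mulf_eq0 (negPf t0) orbF.
    rewrite mulf_eq0 (negPf t0) orbF => x0.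
    by rewrite eK // mulrA.
  by rewrite exchange_big /=; apply: eq_bigr => x _; rewrite big_distrr.
under eq_bigr => x _ do rewrite sumK sum_line mulr0 psi0 mulrBr mulr1.
rewrite sumrB; congr (_ - _).
(* With [x = kap / a * t], the condition that [a * x] lies on the trivial line becomes
   [t ^ q = t]. *)
have inj : injective (fun t => kap / a * t) by apply: mulfI; rewrite mulf_neq0 ?invr_neq0.
rewrite (reindex_inj inj) /=.
transitivity (\sum_(t : F | (t ^+ q == t) && (t != 0)) q%:R * e (kap / a) * 1).
  2: by rewrite -big_distrr /= cardK natrM mulrAC.
rewrite [LHS]big_mkcond [RHS]big_mkcond /=; apply: eq_bigr => t _.
rewrite !mulf_eq0 invr_eq0 (negPf kap0) (negPf a0) /=.
have [->|t0] /= := eqVneq t 0; first by rewrite andbF.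
have -> : a * (kap / a * t) = kap * t by field.
rewrite exprMn kapXq mulNr eqr_opp (inj_eq (mulfI kap0)) andbT.
case: eqP => [tq|_]; last by rewrite mulr0.
by rewrite eK ?mulf_neq0 ?invr_neq0 // mulr1 mulrC.
Qed.

(* [log x %% q.+1] indexes the line through [x]; the signs alternate along the
   (q+1)/4 lines of each quartic class. *)
Definition lsign (x : F) : algC := (-1) ^+ ((log x %% q.+1) %/ 4).
Definition cl4 (x : F) : nat := (log x %% 4)%N.

Let dvd4_q1 : (4 %| q.+1)%N. Proof. lia. Qed.
Let dvdq1_N : (q.+1 %| N)%N. Proof. by rewrite NE dvdn_mulr. Qed.
Let dvd4_N : (4 %| N)%N. Proof. exact: dvdn_trans N8. Qed.

Lemma lsignMr (x t : F) : x != 0 -> t != 0 -> t ^+ q = t -> lsign (x * t) = lsign x.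
Proof.
move=> x0 t0 tq; rewrite /lsign (dlogM FN1 wP) // modn_dvdm //.
by rewrite -modnDmr (eqP (dlog_fixed t0 tq)) addn0.
Qed.

Lemma cl4Mr (x t : F) : x != 0 -> t != 0 -> t ^+ q = t -> cl4 (x * t) = cl4 x.
Proof.
move=> x0 t0 tq; rewrite /cl4 (dlogM FN1 wP) // modn_dvdm // -modnDmr.
have /eqP -> := dvdn_trans dvd4_q1 (dlog_fixed t0 tq).
by rewrite addn0.
Qed.

Lemma lsign_cases (x : F) : lsign x = 1 \/ lsign x = -1.
Proof. by rewrite /lsign -signr_odd; case: odd; [right|left]. Qed.

Lemma cl8_val (x : F) : (cl8 x : nat) = (log x %% 8)%N.
Proof. by rewrite /cl8 Zp_nat. Qed.

(** The exponents split into [q - 1] periods of length [q + 1]. In each period the class [j] meets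
    an odd number of lines with alternating signs starting at [+1], so every period contributes
    1. *)
Lemma sum_lsign (j : nat) : (j < 4)%N ->
  \sum_(x | x != 0) (cl4 x == j)%:R * lsign x = q.-1%:R.
Proof.
move=> j4; pose G (i : nat) : algC := (i %% 4 == j)%N%:R * (-1) ^+ ((i %% q.+1) %/ 4).
rewrite (sum_dlog FN1 wP G) NE.
have GD i m : G (i + q.+1 * m)%N = G i.
  by rewrite /G -modnDmr (eqP (dvdn_mulr m dvd4_q1)) addn0 addnC mulnC modnMDl.
have period m : \sum_(0 <= i < q.+1 * m) G i = m%:R * \sum_(0 <= i < q.+1) G i.
  elim: m => [|m IH]; first by rewrite muln0 big_geq // mul0r.
  rewrite mulnS addnC (@big_cat_nat _ _ _ (q.+1 * m)) ?leq_addr //= IH.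
  rewrite -[m.+1]addn1 natrD mulrDl mul1r; congr (_ + _).
  rewrite -[X in \sum_(X <= _ < _) _]add0n big_addn addKn.
  by apply: eq_bigr => i _; exact: GD.
rewrite period -[RHS]mulr1; congr (_ * _).
have [r qr] : exists r, q.+1 = ((r.*2.+1) * 4)%N by exists (q %/ 8)%N; lia.
rewrite [in LHS]qr.
transitivity (\sum_(0 <= i < r.*2.+1 * 4) (i %% 4 == j)%N%:R * (-1) ^+ (i %/ 4) : algC).
  rewrite !big_nat; apply: eq_bigr => i /andP[_ i_lt].
  by rewrite /G [X in (X %/ 4)%N]modn_small // qr.
have alt m : \sum_(0 <= i < m * 4) (i %% 4 == j)%N%:R * (-1) ^+ (i %/ 4) = (odd m)%:R :> algC.
  elim: m => [|m IH]; first by rewrite big_geq.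
  rewrite mulSn addnC !addnS addn0 !big_nat_recr //= {}IH.
  have d k : (k < 4)%N -> ((m * 4 + k) %% 4 = k)%N /\ ((m * 4 + k) %/ 4 = m)%N by lia.
  have [e0 f0] := d 0%N isT; have [e1 f1] := d 1%N isT.
  have [e2 f2] := d 2%N isT; have [e3 f3] := d 3%N isT.
  rewrite !addnS !addn0 in e0 e1 e2 e3 f0 f1 f2 f3.
  rewrite e0 e1 e2 e3 f0 f1 f2 f3 -[(-1) ^+ m]signr_odd.
  clear -j4; do 4?[case: j j4 => [|j] j4 //=];
    by case: (odd m); rewrite /= ?expr0 ?expr1; ring.
by rewrite alt /= odd_double.
Qed.

(** * Half-blocks and their Fourier transforms *)

Definition profile (v : algC) (c o : seq algC) (x : F) : algC :=
  if x == 0 then v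
  else c`_(cl4 x) * lsign x + o`_(cl4 x) * (-1) ^+ ((log x %% 8) %/ 4).

Lemma profileE (v : algC) (c o : seq algC) (x : F) : x != 0 ->
  profile v c o x = \sum_(0 <= j < 4)
    (c`_j * ((cl4 x == j)%:R * lsign x) + o`_j * octic (cl8 x - j%:R)).
Proof.
move=> x0; rewrite /profile (negPf x0) !big_nat_recr ?big_geq //=.
rewrite -(natr_Zp (cl8 x)) cl8_val /cl4 -(@modn_dvdm 8 (log x) 4) //.
have := @ltn_pmod (log x) 8 isT; move: (log x %% 8)%N => k k8.
by do 8?[case: k k8 => [|k] k8 //]; rewrite !octic_table //=; ring.
Qed.

(** Here [d] and [e] stand for the quartic class and the sign of the line of [kap / a]. The names
    refer to parity in [a]: this part is unchanged under [a |-> - a], and [odd_part] changes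
    sign. *)
Definition even_part (v : algC) (c : seq algC) (d : nat) (e : algC) : algC :=
  v + \sum_(0 <= j < 4) c`_j * (q%:R * e * (d == j)%:R - 1).

Definition odd_part (o : seq algC) (z : 'Z_8) : algC :=
  \sum_(0 <= j < 4) o`_j * gauss (j%:R + z).

Lemma hat_profile (v : algC) (c o : seq algC) (a : F) : a != 0 ->
  hat psi (profile v c o) a =
  even_part v c (cl4 (kap / a)) (lsign (kap / a)) + odd_part o (cl8 a).
Proof.
move=> a0; rewrite /hat (bigD1 0) //= {1}/profile eqxx mulr0 psi0 mulr1 -addrA.
congr (_ + _).
under eq_bigr => x x0 do rewrite profileE // big_distrl /=.
rewrite exchange_big /= -big_split /= !big_nat; apply: eq_bigr => j /andP[_ j4].
under eq_bigr do rewrite mulrDl -!mulrA.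
rewrite big_split -!big_distrr /=; congr (_ * _ + _ * _); last exact: gauss_shift.
have inv (x t : F) : x != 0 -> t != 0 -> t ^+ q = t ->
    (cl4 (x * t) == j)%:R * lsign (x * t) = (cl4 x == j)%:R * lsign x.
  by move=> x0 t0 tq; rewrite cl4Mr // lsignMr.
have q0 : (q.-1%:R : algC) != 0 by rewrite pnatr_eq0; lia.
apply: (mulfI q0); under eq_bigr do rewrite mulrA.
rewrite (sum_line_invariant a0 inv) sum_lsign // natrM mulrBr mulr1; congr (_ - _).
by ring.
Qed.

Lemma hat_profile0 (v : algC) (c o : seq algC) :
  hat psi (profile v c o) 0 = v + \sum_(0 <= j < 4) c`_j * q.-1%:R.
Proof.
rewrite /hat (bigD1 0) //= {1}/profile eqxx mul0r psi0 mulr1; congr (_ + _).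
under eq_bigr => x x0 do rewrite mul0r psi0 mulr1 profileE //.
rewrite exchange_big /= !big_nat; apply: eq_bigr => j /andP[_ j4].
by rewrite big_split -!big_distrr /= sum_lsign // sum_octic mulr0 addr0.
Qed.

(** Since [-1] lies in the subfield, [kap / a] stays on its line, while the octic class of [a]
    shifts by 4. *)
Lemma hat_profileN (v : algC) (c o : seq algC) (a : F) : a != 0 ->
  hat psi (profile v c o) (- a) =
  even_part v c (cl4 (kap / a)) (lsign (kap / a)) - odd_part o (cl8 a).
Proof.
move=> a0; have n10 : -1 != 0 :> F by rewrite oppr_eq0 oner_neq0.
have n1q : (-1) ^+ q = -1 :> F by rewrite -signr_odd (_ : odd q) //; lia.
have ka0 : kap / a != 0 by rewrite mulf_neq0 ?invr_neq0 ?kap_neq0.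
rewrite hat_profile ?oppr_eq0 // invrN mulrN -[- (kap / a)]mulrN1.
rewrite (cl4Mr ka0 n10 n1q) (lsignMr ka0 n10 n1q) cl8N //; congr (_ + _).
rewrite -sumrN; apply: eq_bigr => j _.
by rewrite addrA gaussD4 mulrN.
Qed.

(** The exponent [(q + 1) / 2] of [kap] is 2 modulo 4; writing 10 for 2 avoids truncated
    subtraction. *)
Lemma cl4_kap (a : F) : a != 0 -> cl4 (kap / a) = ((10 - cl8 a) %% 4)%N.
Proof.
move=> a0; have ia0 : a^-1 != 0 by rewrite invr_eq0.
have := dlogM FN1 wP (mulf_neq0 kap_neq0 ia0) a0.
rewrite mulfVK // (dlog_expr FN1 wP) cl8_val /cl4 => E.
have : ((log (kap / a) + log a) %% 4 = (q.+1)./2 %% 4)%N.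
  by rewrite -(modn_dvdm _ dvd4_N) -E modn_dvdm.
lia.
Qed.

(* The halves of the four blocks over [0] ([b = false]) and [1] ([b = true]), found
   by a computer search over all such tables. *)
Definition block (b : bool) (i : nat) : F -> algC :=
  nth (fun=> 0)
   (if b then
     [:: profile (-1) [:: -1; -1; 0; 1] [:: 0; 0; 1; 0];
         profile (-1) [:: 1; -1; 0; -1] [:: 0; 0; 1; 0];
         profile (-1) [:: 1; 1; -1; -1] [:: 0; 0; 0; 0];
         profile (-1) [:: -1; 0; 1; 0] [:: 0; -1; 0; 1]]
    else
     [:: profile 1 [:: 0; 1; 1; -1] [:: 1; 0; 0; 0];
         profile 1 [:: 0; 1; 1; -1] [:: 1; 0; 0; 0];
         profile 1 [:: 1; 1; -1; -1] [:: 0; 0; 0; 0];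
         profile (-1) [:: 1; 0; -1; 0] [:: 0; 1; 0; 1]]) i.

(** * Power spectra and autocorrelations of the blocks *)

(** [e] is the ['Z_2] component of the shift: it pairs each half with itself or with the other
    half. *)
Definition spectrum (e : bool) (a : F) : algC :=
  \sum_(0 <= i < 4) \sum_(b : bool)
    hat psi (block (b (+) e) i) a * hat psi (block b i) (- a).

Lemma spectrum0 (e : bool) :
  spectrum e 0 = if e then - (4 * q%:R ^+ 2) else 4 * q%:R ^+ 2 + 4.
Proof.
rewrite /spectrum !big_nat_recr ?big_geq //= !big_bool /= oppr0.
have q1 : (q.-1%:R : algC) = q%:R - 1 by rewrite -subn1 natrB //; lia.
rewrite /block; case: e => /=; rewrite !hat_profile0 !big_nat_recr ?big_geq //= q1; ring.
Qed.

(** Only the octic class of [a] and the sign of the line of [kap / a] enter. Each of the finitely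
    many cases is a polynomial identity in [q], [gauss 0] and [gauss 1] modulo [norm]. *)
Lemma spectrum_const (e : bool) (a : F) : a != 0 ->
  spectrum e a = if e then 0 else 8 * q%:R ^+ 2 + 4.
Proof.
move=> a0; rewrite /spectrum !big_nat_recr ?big_geq //= !big_bool /=.
have norm : gauss 0 ^+ 2 = - q%:R ^+ 2 - 2 * gauss 1 ^+ 2.
  by rewrite -natrX -gauss_norm; ring.
rewrite /block; case: e => /=; rewrite !hat_profileN // !hat_profile //;
  rewrite cl4_kap // /even_part /odd_part !big_nat_recr ?big_geq //=;
  have [k k8 ->] := Z8_nat (cl8 a);
  do 8?[case: k k8 => [|k] k8 //]; rewrite -!natrD !gauss_table //=;
  by case: (lsign_cases (kap / a)) => ->; ring: norm.
Qed.

(** Fourier inversion: for [e] true only [a = 0] contributes, giving [-4 q ^ 2]; for [e] false and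
    [h != 0] the characters at [a != 0] add up to [-1], giving [4 q ^ 2 + 4 - (8 q ^ 2 + 4)].
    Dividing by [q ^ 2] leaves [-4]. *)
Lemma block_corr (e : bool) (h : F) : e || (h != 0) ->
  \sum_(0 <= i < 4) \sum_(b : bool) \sum_y block (b (+) e) i (y + h) * block b i y = -4.
Proof.
move=> eh.
have n0 : (#|F|%:R : algC) != 0 by rewrite pnatr_eq0 FN1.
apply: (mulfI n0).
transitivity (\sum_a spectrum e a * psi (- (a * h))).
  rewrite big_distrr /=; under [RHS]eq_bigr do rewrite /spectrum big_distrl /=.
  rewrite exchange_big /=; apply: eq_bigr => i _.
  rewrite big_distrr /=; under [RHS]eq_bigr do rewrite big_distrl /=.
  rewrite exchange_big /=; apply: eq_bigr => b _.
  by rewrite (plancherel psiD psi0 psi_neq1).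
rewrite (bigD1 0) //= mul0r oppr0 psi0 mulr1.
under eq_bigr => a a0 do rewrite spectrum_const //.
have : \sum_a psi (- (a * h)) = if h == 0 then #|F|%:R else 0.
  rewrite -oppr_eq0 -(sum_char_mul psiD psi0 psi_neq1).
  by apply: eq_bigr => a _; rewrite mulrN.
rewrite (bigD1 0) //= mul0r oppr0 psi0 => E.
rewrite -big_distrr /= spectrum0; move: E.
set S := \sum_(i | _) _; rewrite FN natrX => E.
have -> : S = (if h == 0 then q%:R ^+ 2 else 0) - 1 by rewrite -E; ring.
by case: e eh => [_|/= /negPf ->]; [case: ifP => _|]; ring.
Qed.

Lemma sum_block (b : bool) (i : nat) : \sum_x block b i x = hat psi (block b i) 0.
Proof. by apply: eq_bigr => x _; rewrite mul0r psi0 mulr1. Qed.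

Lemma sum_blocks (i : nat) : (i < 4)%N ->
  \sum_(b : bool) \sum_x block b i x = if i == 3%N then -2 else 0.
Proof.
move=> i4; rewrite big_bool /= !sum_block.
by do 4?[case: i i4 => [|i] i4 //]; rewrite /block /= !hat_profile0;
  rewrite !big_nat_recr ?big_geq //=; ring.
Qed.

(** On each quartic class exactly one of the two coefficients is nonzero, and it is [1] or [-1]. *)
Lemma block_pm1 (b : bool) (i : nat) (x : F) : (i < 4)%N ->
  block b i x = 1 \/ block b i x = -1.
Proof.
have c4 : (cl4 x < 4)%N by rewrite /cl4 ltn_pmod.
have pm (u : algC) : u = 1 \/ u = -1 <-> u ^+ 2 == 1.
  rewrite sqrf_eq1; split=> [[->|->]|/orP[/eqP|/eqP]]; rewrite ?eqxx ?orbT //; by [left|right].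
have /pm/eqP s2 := lsign_cases x.
pose chi : algC := (-1) ^+ ((log x %% 8) %/ 4).
have c2 : chi ^+ 2 = 1 by rewrite sqrr_sign.
move=> i4; apply/pm; rewrite /block; case: b;
do 4?[case: i i4 => [|i] i4 //]; rewrite /= /profile -/chi; case: (x == 0);
 rewrite ?sqrrN ?expr1n //; move: (cl4 x) c4 => k k4;
 do 4?[case: k k4 => [|k] k4 //]; rewrite /= ?mul0r ?add0r ?addr0 ?mul1r ?mulN1r ?sqrrN ?s2 ?c2 //.
Qed.

End Sums.

(** * From sign functions to sets and difference counts *)

Section SignFunction.

Variables (G : finZmodType) (f : G -> algC).
Hypothesis f_pm1 : forall x, f x = 1 \/ f x = -1.

Let memE (x : G) : (x \in [set x | f x == 1])%:R * 2 = 1 + f x.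
Proof.
rewrite inE; case: (f_pm1 x) => ->; first by rewrite eqxx mul1r.
by rewrite -subr_eq0 -opprD oppr_eq0 (_ : 1 + 1 = 2%:R) // pnatr_eq0 mul0r subrr.
Qed.

Let card_sum (A : {set G}) : #|A|%:R = \sum_x (x \in A)%:R :> algC.
Proof. by rewrite -sum1_card natr_sum big_mkcond; apply: eq_bigr => x _; case: ifP. Qed.

Lemma card_sign_set : #|[set x | f x == 1]|%:R * 2 = #|G|%:R + \sum_x f x.
Proof.
rewrite card_sum big_distrl /=; under eq_bigr do rewrite memE.
by rewrite big_split sumr_const.
Qed.

(** The indicator of the set is [(1 + f) / 2]; the product of its values at [x] and [x + g] is
    expanded. *)
Lemma diff_count_sign_set (g : G) : g != 0 ->
  (diff_count [set x | f x == 1] g)%:R * 4 =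
  #|G|%:R + 2 * \sum_x f x + \sum_x f (x + g) * f x.
Proof.
move=> g0; set B := [set x | f x == 1].
(* A pair with difference [g] is determined by its second entry, and its entries are distinct
   because [g != 0]. *)
have -> : diff_count B g = #|[set x | (x \in B) && (x + g \in B)]|.
  have inj : injective (fun x : G => (x + g, x)) by move=> x y [].
  rewrite /diff_count -(card_imset _ inj); apply: eq_card => -[x y].
  rewrite !inE /=; apply/and4P/imsetP => [[fx fy _ /eqP <-]|[z]].
    by exists y; rewrite ?inE ?fy 1?addrC subrK ?fx.
  rewrite !inE => /andP[fz fzg] [-> ->]; split=> //.
    by rewrite -subr_eq0 addrAC subrr add0r.
  by rewrite addrAC subrr add0r.
rewrite card_sum big_distrl /=.
transitivity (\sum_x (1 + f x + f (x + g) + f (x + g) * f x)).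
  apply: eq_bigr => x _; rewrite inE.
  transitivity ((1 + f x) * (1 + f (x + g))); last by ring.
  by rewrite -!memE -/B; case: (x \in B); case: (x + g \in B); rewrite /=; ring.
have shift : \sum_x f (x + g) = \sum_x f x by rewrite [RHS](reindex_inj (addIr g)).
by rewrite !big_split sumr_const shift /=; ring.
Qed.

End SignFunction.

(** * Assembly on the product group *)

Lemma big_Z2 (H : bool -> algC) : \sum_(z : 'Z_2) H (z != 0) = \sum_(b : bool) H b.
Proof. by rewrite big_bool !big_ord_recl big_ord0 /= addr0 addrC. Qed.

Lemma Z2_neq0D (z e : 'Z_2) : (z + e != 0) = (z != 0) (+) (e != 0).
Proof. by move: z e => [[|[|m]] mP] [[|[|k]] kP]. Qed.

Theorem theorem1p2 (q : nat) (c : int) (F : finFieldType)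
  (hq : prime_power q)
  (hc : (q%:Z = 12 * c ^+ 2 + 4 * c + 3)%R)
  (hF : #|F| = (q ^ 2)%N) :
  let n := (q ^ 2)%N in
  exists B : 'I_4 -> {set ('Z_2 * F)%type},
    is_difference_family B (fun i => nth 0%N [:: n; n; n; n.-1] i) (2 * n - 2).
Proof.
move=> n.
have q8 : (q %% 8 = 3)%N.
  have [d cd] : exists d : int, c = 2 * d \/ c = 2 * d + 1.
    by exists (c %/ 2)%Z; lia.
  (* Naming the square [e] makes the remaining congruence linear. *)
  have : exists2 e : int, d ^+ 2 = e &
      (q%:Z = 8 * (6 * e + d) + 3) \/ (q%:Z = 8 * (6 * e + 7 * d + 2) + 3).
    by exists (d ^+ 2) => //; rewrite hc; case: cd => ->; [left|right]; ring.
  by case=> e _ []; lia.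
have qF : [pchar F].-nat q.
  have [p [k [pp k0 qE]]] := hq; rewrite qE pnatX pnatE // (@card_finPcharP _ p (k * 2)) //.
  by rewrite hF qE expnM.
have q2 : (2 < q)%N by lia.
have [psi [psiD psi0 psiq psi_ker psi_nker]] := exists_trace_char qF q2 hF.
have [w wP] := exists_prim_root F; rewrite hF in wP.
pose f (i : nat) (p : 'Z_2 * F) := block q w (p.1 != 0) i p.2.
have fpm (i : 'I_4) p : f i p = 1 \/ f i p = -1 by exact: block_pm1.
have cardG : #|{: 'Z_2 * F}| = (2 * n)%N by rewrite card_prod card_ord hF.
have sum_f (i : 'I_4) : \sum_p f i p = if i == 3%N :> nat then -2 else 0.
  rewrite -(sum_blocks qF q8 hF wP psi0 (ltn_ord i)).
  rewrite -(big_Z2 (fun b => \sum_x block q w b i x)).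
  by rewrite pair_bigA.
have n1 : (0 < n)%N by rewrite expn_gt0; lia.
exists (fun i : 'I_4 => [set p | f i p == 1]); split=> [i|g g0].
  apply/eqP; rewrite -(eqr_nat algC) -(inj_eq (mulIf (_ : 2 != 0 :> algC))) ?pnatr_eq0 //.
  rewrite card_sign_set // cardG sum_f.
  case: i => [[|[|[|[|]]]] ?] //=; rewrite ?addr0 natrM ?[2 * _]mulrC //.
  by rewrite -subn1 natrB //; apply/eqP; ring.
(* Four times the count is [4 (2 n)] from the group order, [2 (-2)] from the block sums and [-4]
   from the correlations, that is [4 (2 n - 2)]. *)
apply/eqP; rewrite -(eqr_nat algC) -(inj_eq (mulIf (_ : 4 != 0 :> algC))) ?pnatr_eq0 //.
rewrite natr_sum big_distrl /=.
under eq_bigr => i _ do rewrite diff_count_sign_set // cardG sum_f.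
rewrite big_split /=.
have -> : \sum_(i < 4) \sum_x f i (x + g) * f i x = -4.
  have gg : (g.1 != 0) || (g.2 != 0).
    by move: g0; case: g => a b; rewrite xpair_eqE negb_and.
  rewrite -(block_corr qF q8 hF wP psiD psi0 psiq psi_ker psi_nker gg) big_mkord.
  apply: eq_bigr => i _.
  rewrite -(big_Z2 (fun b => \sum_y block q w (b (+) (g.1 != 0)) i (y + g.2) * block q w b i y)).
  by rewrite pair_bigA; apply: eq_bigr => -[z x] _; rewrite /f /= Z2_neq0D.
rewrite !big_ord_recl big_ord0 /= natrM natrB; last by lia.
by rewrite natrM; apply/eqP; ring.
Qed.
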